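(* Let $D\ge1$, let $\mathcal{A}^D_{\hbar,q}(\mathcal{F})$ be a shift algebra such that $\mathcal{F}$ separates points of $\mathbb{R}^D$, and let $\mathcal{A}$ be a shift subalgebra of $\mathcal{A}^D_{\hbar,q}(\mathcal{F})$. Let $\delta\in\mathbb{R}^D$, and for $k\in\mathbb{Z}^D$ let $\mathcal{S}_\hbar^\delta(|k\rangle)\subseteq\mathcal{S}_\hbar(\mathbb{1},\delta)$ denote the $\mathcal{A}$-module generated by $|k\rangle$. Then $\mathcal{S}_\hbar^\delta(|k\rangle)$ is a simple $\mathcal{A}$-module.
   Context: $F(\mathbb{R}^D,\mathbb{C})$ is the $\ast$-algebra of all complex valued functions on $\mathbb{R}^D$ (involution = complex conjugation). For $\hbar>0$, $k\in\mathbb{Z}^D$ put $(S_\hbar^k f)(u)=f(u+k\hbar)$. A $\ast$-subalgebra $\mathcal{F}\subseteq F(\mathbb{R}^D,\mathbb{C})$ is $\hbar$-invariant if $S_\hbar^kf\in\mathcal{F}$ for all $f\in\mathcal{F}$, $k\in\mathbb{Z}^D$; it separates points if for any distinct $x,y\in\mathbb{R}^D$ there is $f\in\mathcal{F}$ with $f(x)\ne f(y)$. For $k,l\in\mathbb{R}^D$ let $N(k,l)=\sum_{m=2}^D\sum_{n=1}^{m-1}k_ml_n$ (and $N=0$ if $D=1$). For $q\in\mathbb{C}$, $|q|=1$, a real $\theta$ with $q=e^{i\theta}$ is fixed and $q^t=e^{i\theta t}$ for $t\in\mathbb{R}$. Shift algebra: for $\hbar>0$, $|q|=1$ and $\mathcal{F}$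 an $\hbar$-invariant $\ast$-subalgebra of $F(\mathbb{R}^D,\mathbb{C})$, $\mathcal{A}^D_{\hbar,q}(\mathcal{F})$ consists of finite formal sums $\sum_{k\in\mathbb{Z}^D}f_kU^k$, $f_k\in\mathcal{F}$, with product $(\sum_kf_kU^k)(\sum_lg_lU^l)=\sum_{k,l}q^{N(k,l)}f_k(S_\hbar^kg_l)U^{k+l}$ and involution $(\sum_kf_kU^k)^\ast=\sum_kq^{N(k,k)}(S_\hbar^k\overline{f_{-k}})U^k$. A shift subalgebra is a $\ast$-subalgebra $\mathcal{A}\subseteq\mathcal{A}^D_{\hbar,q}(\mathcal{F})$ such that $fa\in\mathcal{A}$ for all $f\in\mathcal{F}$, $a\in\mathcal{A}$ (with $f$ identified with $fU^0$). Module: $\mathcal{S}_\hbar(\mathbb{1},\delta)$ is the left $\mathcal{A}^D_{\hbar,q}(\mathcal{F})$-module with vector space basis $\{|k\rangle\}_{k\in\mathbb{Z}^D}$ (the finitely supported functions on $\mathbb{Z}^D$, $|k\rangle$ the indicator function of $k$) and action $$\Big(\sum_nf_nU^n\Big)|k\rangle=\sum_{n\in\mathbb{Z}^D}q^{N(k-n+\delta,n)}f_n\big((k-n+\delta)\hbar\big)|k-n\rangle .$$ It is a left module over every subalgebra by restriction. The $\mathcal{A}$-module generated by $|k\rangle$ is the smallest $\mathcal{A}$-invariant linear subspace containing $|k\rangle$. A module is simple if it is nonzero and its only submodules are $0$ and itself. *)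

(* Defs.v *)
From HB Require Import structures.
From mathcomp Require Export all_boot all_order all_algebra.
From mathcomp Require Export all_classical reals trigo.
From mathcomp Require Export complex finmap monalg.

Set Implicit Arguments.
Unset Strict Implicit.
Unset Printing Implicit Defensive.

Import Order.TTheory GRing.Theory Num.Theory.

Local Open Scope classical_set_scope.
Local Open Scope complex_scope.
Local Open Scope ring_scope.

Definition expi (R : realType) (t : R) : R[i] := cos t +i* sin t.

(* q ^ t for the branch q = exp(i theta) fixed by theta. *)
Definition qpow (R : realType) (theta t : R) : R[i] := expi (theta * t).

(* Coordinates are numbered from 0, so the sum over 2 <= m <= D, 1 <= n <= m-1
   becomes the sum over 0 <= n < m < D. *)
Definition Nform (R : realType) (D : nat) (k l : 'rV[R]_D) : R :=
  \sum_(m < D) \sum_(n < D | (n < m)%N) k 0 m * l 0 n.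

Definition intv (R : realType) (D : nat) (k : 'rV[int]_D) : 'rV[R]_D :=
  map_mx intr k.

Notation cfun R D := ('rV[R]_D -> R[i]).

Definition conjf (R : realType) (D : nat) (f : cfun R D) : cfun R D :=
  fun u => conjc (f u).

Definition shiftf (R : realType) (D : nat) (hbar : R) (k : 'rV[int]_D)
    (f : cfun R D) : cfun R D :=
  fun u => f (u + hbar *: intv R k).

(* Operations on functions are pointwise.  Subalgebras need not be unital. *)
Definition fun_star_subalgebra (R : realType) (D : nat)
    (F : set (cfun R D)) : Prop :=
  [/\ F 0,
      forall (c : R[i]) (f g : cfun R D), F f -> F g -> F (c *: f + g),
      forall f g : cfun R D, F f -> F g -> F (f * g)
    & forall f : cfun R D, F f -> F (conjf f)].

Definition hbar_invariant (R : realType) (D : nat) (hbar : R)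
    (F : set (cfun R D)) : Prop :=
  forall (f : cfun R D) (k : 'rV[int]_D), F f -> F (shiftf hbar k f).

Definition separates_points (R : realType) (D : nat)
    (F : set (cfun R D)) : Prop :=
  forall x y : 'rV[R]_D, x <> y -> exists2 f, F f & f x <> f y.

(* Finite formal sums \sum_k f_k U^k with arbitrary coefficients f_k; the
   monomial f U^k is << f *g k >> and f_k is a@_k.  The product is [shift_mul],
   not a ring structure of {malg _[_]}. *)
Notation formal_sum R D := {malg (cfun R D)['rV[int]_D]}.

Definition shift_alg (R : realType) (D : nat) (F : set (cfun R D)) :
    set (formal_sum R D) :=
  [set a | forall k, F a@_k].

Definition shift_scale (R : realType) (D : nat) (c : R[i])
    (a : formal_sum R D) : formal_sum R D :=
  \sum_(k <- msupp a) << c *: a@_k *g k >>.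

Definition shift_mul (R : realType) (D : nat) (hbar theta : R)
    (a b : formal_sum R D) : formal_sum R D :=
  \sum_(k <- msupp a) \sum_(l <- msupp b)
    << qpow theta (Nform (intv R k) (intv R l)) *:
         (a@_k * shiftf hbar k b@_l) *g k + l >>.

(* The coefficient of U^k can only be nonzero when -k is in the support. *)
Definition shift_star (R : realType) (D : nat) (hbar theta : R)
    (a : formal_sum R D) : formal_sum R D :=
  \sum_(k <- [seq - l | l <- msupp a])
    << qpow theta (Nform (intv R k) (intv R k)) *:
         shiftf hbar k (conjf a@_(- k)) *g k >>.

Definition shift_subalgebra (R : realType) (D : nat) (hbar theta : R)
    (F : set (cfun R D)) (A : set (formal_sum R D)) : Prop :=
  [/\ A `<=` shift_alg F,
      [/\ A 0,
          forall a b, A a -> A b -> A (a + b)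
        & forall c a, A a -> A (shift_scale c a)],
      forall a b, A a -> A b -> A (shift_mul hbar theta a b),
      forall a, A a -> A (shift_star hbar theta a)
    & forall f a, F f -> A a -> A (shift_mul hbar theta << f *g 0 >> a)].

(* Carrier of the module: finitely supported functions on Z^D. *)
Notation shift_module R D := {malg R[i]['rV[int]_D]}.

Definition ket (R : realType) (D : nat) (k : 'rV[int]_D) : shift_module R D :=
  << 1 *g k >>.

Definition act_ket (R : realType) (D : nat) (hbar theta : R)
    (delta : 'rV[R]_D) (a : formal_sum R D) (k : 'rV[int]_D) :
    shift_module R D :=
  \sum_(n <- msupp a)
    (qpow theta (Nform (intv R (k - n) + delta) (intv R n)) *
     a@_n (hbar *: (intv R (k - n) + delta))) *: ket R (k - n).

Definition act (R : realType) (D : nat) (hbar theta : R)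
    (delta : 'rV[R]_D) (a : formal_sum R D) (v : shift_module R D) :
    shift_module R D :=
  \sum_(k <- msupp v) v@_k *: act_ket hbar theta delta a k.

Definition invariant_subspace (R : realType) (D : nat) (hbar theta : R)
    (delta : 'rV[R]_D) (A : set (formal_sum R D))
    (W : set (shift_module R D)) : Prop :=
  [/\ W 0,
      forall (c : R[i]) v w, W v -> W w -> W (c *: v + w)
    & forall a v, A a -> W v -> W (act hbar theta delta a v)].

Definition generated_module (R : realType) (D : nat) (hbar theta : R)
    (delta : 'rV[R]_D) (A : set (formal_sum R D)) (k : 'rV[int]_D) :
    set (shift_module R D) :=
  smallest (invariant_subspace hbar theta delta A) [set ket R k].

Definition simple_module (R : realType) (D : nat) (hbar theta : R)
    (delta : 'rV[R]_D) (A : set (formal_sum R D))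
    (M : set (shift_module R D)) : Prop :=
  [/\ invariant_subspace hbar theta delta A M,
      M <> [set 0]
    & forall W, invariant_subspace hbar theta delta A W -> W `<=` M ->
        W = [set 0] \/ W = M].

(* Main.v *)
(** Elements of F act diagonally on the kets.  Since F is hbar-invariant and
    separates points, for every finite set of lattice points it contains a
    function equal to 1 at one of them and to 0 at the others.  Multiplying
    elements of A by such functions isolates single kets, so the module
    generated by |k> is spanned by |k> and by the |j> with <j|a|k> <> 0 for
    some a in A.  The star of A is the adjoint for the basis of kets, so such a
    |j> can be sent back to |k>; hence every nonzero submodule contains |k>. *)

Require Import Defs.
From mathcomp Require Import ring.

Set Implicit Arguments.
Unset Strict Implicit.
Unset Printing Implicit Defensive.

Import Order.TTheory GRing.Theory Num.Theory.

Local Open Scope classical_set_scope.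
Local Open Scope complex_scope.
Local Open Scope ring_scope.

(** * Phases, the bilinear form N and integer vectors *)

Lemma expiD (R : realType) (s t : R) : expi (s + t) = expi s * expi t.
Proof.
by rewrite /expi cosD sinD [sin s * _ + _]addrC.
Qed.

Lemma conjc_expi (R : realType) (t : R) : (expi t)^* = expi (- t).
Proof. by rewrite /expi cosN sinN. Qed.

Lemma qpowD (R : realType) (theta s t : R) :
  qpow theta (s + t) = qpow theta s * qpow theta t.
Proof. by rewrite /qpow mulrDr expiD. Qed.

Lemma qpow0 (R : realType) (theta : R) : qpow theta 0 = 1.
Proof. by rewrite /qpow mulr0 /expi cos0 sin0. Qed.

Lemma conjc_qpow (R : realType) (theta t : R) :
  (qpow theta t)^* = qpow theta (- t).
Proof. by rewrite /qpow conjc_expi mulrN. Qed.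

Lemma NformDl (R : realType) (D : nat) (k k' l : 'rV[R]_D) :
  Nform (k + k') l = Nform k l + Nform k' l.
Proof.
rewrite /Nform -big_split; apply: eq_bigr => m _ /=.
by rewrite -big_split; apply: eq_bigr => n _ /=; rewrite mxE mulrDl.
Qed.

Lemma NformDr (R : realType) (D : nat) (k l l' : 'rV[R]_D) :
  Nform k (l + l') = Nform k l + Nform k l'.
Proof.
rewrite /Nform -big_split; apply: eq_bigr => m _ /=.
by rewrite -big_split; apply: eq_bigr => n _ /=; rewrite mxE mulrDr.
Qed.

Lemma Nform0r (R : realType) (D : nat) (k : 'rV[R]_D) : Nform k 0 = 0.
Proof. by apply: (addrI (Nform k 0)); rewrite -NformDr !addr0. Qed.

Lemma NformNr (R : realType) (D : nat) (k l : 'rV[R]_D) :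
  Nform k (- l) = - Nform k l.
Proof.
by apply: (addrI (Nform k l)); rewrite -NformDr !subrr Nform0r.
Qed.

Lemma intvD (R : realType) (D : nat) (k l : 'rV[int]_D) :
  intv R (k + l) = intv R k + intv R l.
Proof. exact: map_mxD. Qed.

Lemma intvN (R : realType) (D : nat) (k : 'rV[int]_D) :
  intv R (- k) = - intv R k.
Proof. exact: map_mxN. Qed.

Lemma intv0 (R : realType) (D : nat) : intv R (0 : 'rV[int]_D) = 0.
Proof. exact: map_mx0. Qed.

Lemma intv_inj (R : realType) (D : nat) : injective (@intv R D).
Proof.
move=> k l /matrixP kl; apply/matrixP => i j.
by have := kl i j; rewrite !mxE => /intr_inj.
Qed.

(** Collapses the sums over supports met below to one index. The hypothesis covers an [m] outside
    the support, where both sides vanish. *)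
Lemma sum_msupp_pick (G : zmodType) (K : choiceType) (V : nmodType)
    (a : {malg G[K]}) (m : K) (h : K -> V) :
  (a@_m = 0 -> h m = 0) ->
  \sum_(n <- msupp a) (if n == m then h n else 0) = h m.
Proof.
move=> h0; rewrite -big_mkcond /=.
case: (boolP (m \in msupp a)) => [ma|/[dup] ma /mcoeff_outdom/h0 ->].
  rewrite -big_filter filter_pred1_uniq ?fset_uniq //; exact: big_seq1.
by rewrite big1_seq // => n /andP[/eqP -> /=]; rewrite (negbTE ma).
Qed.

(** * Matrix elements of the action in the basis of kets *)

Section ShiftAlgebra.
Variables (R : realType) (D : nat) (hbar theta : R).
Implicit Types (a b : formal_sum R D) (j k m n : 'rV[int]_D) (u : 'rV[R]_D).

Lemma shift_mul_coefE a b m u :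
  (shift_mul hbar theta a b)@_m u =
  \sum_(n <- msupp a) qpow theta (Nform (intv R n) (intv R (m - n))) *
    (a@_n u * b@_(m - n) (u + hbar *: intv R n)).
Proof.
rewrite /shift_mul raddf_sum fct_sumE; apply: eq_bigr => n _.
rewrite raddf_sum fct_sumE.
pose h l := qpow theta (Nform (intv R n) (intv R l)) *
              (a@_n u * b@_l (u + hbar *: intv R n)).
rewrite -[RHS]/(h (m - n)) -(@sum_msupp_pick _ _ _ b (m - n) h).
  apply: eq_bigr => l _; rewrite /= mcoeffU eq_sym addrC -subr_eq eq_sym.
  by case: eqP.
by rewrite /h => ->; rewrite !mulr0.
Qed.

Lemma shift_star_coefE a m u :
  (shift_star hbar theta a)@_m u =
  qpow theta (Nform (intv R m) (intv R m)) *
    (a@_(- m) (u + hbar *: intv R m))^*.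
Proof.
rewrite /shift_star raddf_sum fct_sumE big_map.
pose h n := qpow theta (Nform (intv R (- n)) (intv R (- n))) *
              (a@_n (u + hbar *: intv R (- n)))^*.
transitivity (h (- m)); last by rewrite /h opprK.
rewrite -(@sum_msupp_pick _ _ _ a (- m) h).
  apply: eq_bigr => l _; rewrite /= mcoeffU eqr_oppLR /h.
  by case: eqP => // ->; rewrite !opprK.
by rewrite /h => ->; rewrite /= raddf0 mulr0.
Qed.

Variable delta : 'rV[R]_D.

Definition lattice_pt j : 'rV[R]_D := hbar *: (intv R j + delta).

(* The matrix element <j| a |k>. *)
Definition act_coef a j k : R[i] :=
  qpow theta (Nform (intv R j + delta) (intv R (k - j))) *
  a@_(k - j) (lattice_pt j).

Lemma act_ket_coefE a j k :
  (act_ket hbar theta delta a k)@_j = act_coef a j k.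
Proof.
rewrite /act_ket raddf_sum.
pose h n := qpow theta (Nform (intv R (k - n) + delta) (intv R n)) *
              a@_n (lattice_pt (k - n)).
have -> : act_coef a j k = h (k - j) by rewrite /h subKr.
rewrite -(@sum_msupp_pick _ _ _ a (k - j) h) => [|a0].
  apply: eq_bigr => n _; rewrite /= mcoeffZ mcoeffU -subr_eq0 addrAC subr_eq0 eq_sym.
  by case: eqP => // _; rewrite ?mulr1 ?mulr0.
by rewrite /h a0 mulr0.
Qed.

Lemma act_coefE a (v : shift_module R D) j :
  (act hbar theta delta a v)@_j = \sum_(i <- msupp v) v@_i * act_coef a j i.
Proof.
rewrite /act raddf_sum; apply: eq_bigr => i _.
by rewrite /= mcoeffZ act_ket_coefE.
Qed.

(** This is the matrix product: the intermediate ket is [j + n], and only finitely many of these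
    contribute because [a] has finite support. *)
Lemma act_coefM a b j k :
  act_coef (shift_mul hbar theta a b) j k =
  \sum_(n <- msupp a) act_coef a j (j + n) * act_coef b (j + n) k.
Proof.
rewrite /act_coef shift_mul_coefE mulr_sumr; apply: eq_bigr => n _.
rewrite [j + n - j]addrAC subrr add0r opprD addrA.
have -> : lattice_pt (j + n) = lattice_pt j + hbar *: intv R n.
  by rewrite /lattice_pt intvD -scalerDr addrAC.
set p := k - j - n; have -> : k - j = n + p by rewrite /p [RHS]addrC subrK.
(* The phases agree since N(n, p) + N(j + delta, n + p) = N(j + delta, n) + N(j + n + delta, p). *)
rewrite mulrA -qpowD mulrACA -qpowD; congr (qpow _ _ * _).
by rewrite !intvD !NformDl !NformDr; ring.
Qed.

(** In the matrix product only the intermediate index n = 0 survives, so [f] acts diagonally. *)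
Lemma act_coef_funM f a j k :
  act_coef (shift_mul hbar theta << f *g 0 >> a) j k =
  f (lattice_pt j) * act_coef a j k.
Proof.
rewrite act_coefM.
pose h n := act_coef << f *g 0 >> j (j + n) * act_coef a (j + n) k.
transitivity (h 0).
  rewrite -(@sum_msupp_pick _ _ _ << f *g 0 >> 0 h) => [|].
    rewrite big_seq [RHS]big_seq; apply: eq_bigr => n /(fsubsetP msuppU_le).
    by rewrite inE => ->.
  (* If [f] is zero, then 0 is not in the support of the monomial. *)
  by rewrite mcoeffUU => f0; rewrite /h /act_coef f0 monalgU0 mcoeff0 mulr0 mul0r.
by rewrite /h addr0 {1}/act_coef subrr mcoeffUU intv0 Nform0r qpow0 mul1r.
Qed.

Lemma act_fun_coefE f a (v : shift_module R D) j :
  (act hbar theta delta (shift_mul hbar theta << f *g 0 >> a) v)@_j =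
  f (lattice_pt j) * (act hbar theta delta a v)@_j.
Proof.
rewrite [LHS]act_coefE [X in _ = _ * X]act_coefE [RHS]mulr_sumr.
apply: eq_bigr => i _.
by rewrite act_coef_funM mulrCA.
Qed.

(** The factor q^N(k,k) in the involution is what makes the star the adjoint: N(j + delta, k - j) +
    N(k - j, k - j) = N(k + delta, k - j). *)
Lemma act_coef_star a j k :
  act_coef (shift_star hbar theta a) j k = (act_coef a k j)^*.
Proof.
rewrite /act_coef shift_star_coefE rmorphM /= conjc_qpow opprB mulrA -qpowD.
have -> : lattice_pt j + hbar *: intv R (k - j) = lattice_pt k.
  by rewrite /lattice_pt -scalerDr addrAC -intvD [j + _]addrC subrK.
congr (qpow _ _ * _).
rewrite -[j - k]opprB intvN NformNr opprK.
have -> : intv R k + delta = intv R j + delta + intv R (k - j).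
  by rewrite addrAC -intvD [j + _]addrC subrK.
by rewrite [RHS]NformDl.
Qed.
End ShiftAlgebra.

(** * Interpolation at finitely many points by functions in F *)

Section FiniteInterpolation.
Variables (R : realType) (D : nat) (hbar : R) (F : set (cfun R D)).
Hypothesis D_gt0 : (0 < D)%N.
Hypothesis hbar_gt0 : 0 < hbar.
Hypothesis Falg : fun_star_subalgebra F.
Hypothesis Finv : hbar_invariant hbar F.
Hypothesis Fsep : separates_points F.
Implicit Types (x y : 'rV[R]_D) (f : cfun R D).

(* A common zero of F would make all its hbar-translates common zeros, and F
   would not separate them; so no unit is needed. *)
Lemma exists_fun_neq0 x : exists2 f, F f & f x != 0.
Proof.
pose e : 'rV[int]_D := const_mx 1.
have xe : x <> x + hbar *: intv R e.
  move/eqP; rewrite -subr_eq0 opprD addrA subrr add0r oppr_eq0 scaler_eq0.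
  rewrite gt_eqF //= => /eqP/matrixP/(_ 0 (Ordinal D_gt0)).
  by rewrite !mxE => /eqP; rewrite oner_eq0.
have [f Ff fx] := Fsep xe.
have [fx0|] := eqVneq (f x) 0; last by exists f.
exists (shiftf hbar e f); first exact: Finv.
by apply/eqP; rewrite /shiftf => fe0; apply: fx; rewrite fx0 fe0.
Qed.

Lemma exists_fun_zero_at x y : x != y ->
  exists2 f, F f & f x != 0 /\ f y = 0.
Proof.
move=> /eqP/Fsep[h Fh hxy]; have [f Ff fx] := exists_fun_neq0 x.
have [_ FZD FM _] := Falg.
(* This is (h - h(y)) f; the factor [f] replaces the constant h(y), which may lie outside [F], by an
   element of [F]. *)
exists (- h y *: f + h * f); first by apply: FZD => //; apply: FM.
split; last by rewrite -[LHS]/(- h y * f y + h y * f y) mulNr addNr.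
rewrite -[X in X != _]/(- h y * f x + h x * f x) -mulrDl mulf_neq0 //.
by rewrite addrC subr_eq0; apply/eqP.
Qed.

Lemma exists_fun_indicator (s : seq 'rV[R]_D) x :
  exists2 f, F f & f x = 1 /\ {in s, forall y, y != x -> f y = 0}.
Proof.
have [F0 FZD FM _] := Falg.
(* The value at [x] can be normalised at the end, so a product of functions, one for each point to
   be killed, suffices. *)
suff [f Ff [fx fs]] :
    exists2 f, F f & f x != 0 /\ {in s, forall y, y != x -> f y = 0}.
  exists ((f x)^-1 *: f + 0); first exact: FZD.
  split=> [|y ys yx]; rewrite addr0; first exact: mulVf.
  by rewrite -[LHS]/((f x)^-1 * f y) (fs y) // mulr0.
elim: s => [|y s [f Ff [fx fs]]].
  by have [f Ff fx] := exists_fun_neq0 x; exists f.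
have [yx|xy] := eqVneq y x.
  by exists f => //; split=> // z; rewrite inE yx => /predU1P[->/eqP|/fs].
have [|g Fg [gx gy]] := @exists_fun_zero_at x y; first by rewrite eq_sym.
exists (f * g); first exact: FM.
split=> [|z]; first by rewrite -[X in X != _]/(f x * g x) mulf_neq0.
rewrite inE => /predU1P[->|zs] zx; rewrite -[LHS]/(f _ * g _).
  by rewrite gy mulr0.
by rewrite fs // mul0r.
Qed.

Lemma lattice_pt_inj (delta : 'rV[R]_D) : injective (lattice_pt hbar delta).
Proof.
move=> i j /(scalerI (lt0r_neq0 hbar_gt0)) /addIr; exact: intv_inj.
Qed.

Lemma exists_lattice_indicator (delta : 'rV[R]_D) (s : seq 'rV[int]_D)
    (j : 'rV[int]_D) :
  exists2 f, F f & f (lattice_pt hbar delta j) = 1 /\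
    {in s, forall i, i != j -> f (lattice_pt hbar delta i) = 0}.
Proof.
have [f Ff [f1 f0]] := exists_fun_indicator
  (map (lattice_pt hbar delta) s) (lattice_pt hbar delta j).
exists f => //; split=> // i si ij.
by apply: f0; rewrite ?map_f // (inj_eq (@lattice_pt_inj delta)).
Qed.

End FiniteInterpolation.

(** * Kets in invariant subspaces, and simplicity *)

Section SimpleModule.
Variables (R : realType) (D : nat) (hbar theta : R) (F : set (cfun R D)).
Hypothesis D_gt0 : (0 < D)%N.
Hypothesis hbar_gt0 : 0 < hbar.
Hypothesis Falg : fun_star_subalgebra F.
Hypothesis Finv : hbar_invariant hbar F.
Hypothesis Fsep : separates_points F.
Variable A : set (formal_sum R D).
Hypothesis Asub : shift_subalgebra hbar theta F A.
Variable delta : 'rV[R]_D.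
Implicit Types (i j k : 'rV[int]_D) (v : shift_module R D).

Local Notation pt := (lattice_pt hbar delta).
Local Notation coef := (act_coef hbar theta delta).
Local Notation invariant := (invariant_subspace hbar theta delta A).
Local Notation indicator :=
  (exists_lattice_indicator D_gt0 hbar_gt0 Falg Finv Fsep delta).

Lemma invariant_scale_ket (W : set (shift_module R D)) (c : R[i]) j :
  invariant W -> c != 0 -> W (c *: ket R j) -> W (ket R j).
Proof.
move=> [W0 WZD _] c0 /(WZD c^-1 _ 0); rewrite scalerA mulVf // scale1r addr0.
exact.
Qed.

(** An indicator [f] need not lie in [A], but f a does; applied to [v] it leaves only the [j]-th
    term of a v. *)
Lemma invariant_ket (W : set (shift_module R D)) a v j :
  invariant W -> A a -> W v -> (act hbar theta delta a v)@_j != 0 ->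
  W (ket R j).
Proof.
move=> Winv Aa Wv avj; apply: (invariant_scale_ket Winv avj).
have [f Ff [f1 f0]] := indicator (msupp (act hbar theta delta a v)) j.
have [_ _ _ _ /(_ f a Ff Aa) Afa] := Asub.
have [_ _ /(_ _ _ Afa Wv)] := Winv; congr W; apply/malgP => i.
rewrite act_fun_coefE mcoeffZ mcoeffU.
have [<-|ij] := eqVneq j i; first by rewrite f1 mul1r mulr1.
rewrite mulr0; case: (boolP (i \in msupp (act hbar theta delta a v))) => [iv|].
  by rewrite f0 ?mul0r // eq_sym.
by move/mcoeff_outdom ->; rewrite mulr0.
Qed.

(** The case [j = k] is separate because [A] may lack a unit and may even annihilate the
    generator. *)
Definition reachable k j := j = k \/ exists2 a, A a & coef a j k != 0.

Lemma reachable_step a i j k :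
  A a -> coef a j i != 0 -> reachable k i -> reachable k j.
Proof.
move=> Aa /[swap] -[->|[b Ab bik]] aji; right; first by exists a.
(* The sum for <j|a b|k> could cancel. Inserting the indicator of [i] between [a] and [b] keeps only
   the path through [i]. *)
have [f Ff [f1 f0]] := indicator [seq j + n | n <- msupp a] i.
have [_ _ AM _ /(_ f b Ff Ab) Afb] := Asub.
exists (shift_mul hbar theta a (shift_mul hbar theta << f *g 0 >> b)).
  exact: AM.
rewrite act_coefM.
pose h n := coef a j (j + n) * coef b (j + n) k.
suff -> : \sum_(n <- msupp a) coef a j (j + n) *
    coef (shift_mul hbar theta << f *g 0 >> b) (j + n) k = h (i - j).
  by rewrite /h addrC subrK mulf_neq0.
rewrite -(@sum_msupp_pick _ _ _ a (i - j) h) => [|a0].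
  rewrite big_seq [RHS]big_seq; apply: eq_bigr => n an.
  rewrite act_coef_funM eq_sym subr_eq [n + j]addrC eq_sym.
  have [jni|jni] := eqVneq (j + n) i; first by rewrite jni f1 mul1r /h jni.
  by rewrite f0 ?mul0r ?mulr0 // map_f.
by rewrite /h [j + _]addrC subrK /act_coef a0 mulr0 mul0r.
Qed.

Lemma reachable_invariant k :
  invariant [set v | {in msupp v, forall j, reachable k j}].
Proof.
split=> /= [j|c v w Hv Hw j|a v Aa Hv j]; first by rewrite msupp0.
  move=> /(fsubsetP (msuppD_le _ _)); rewrite inE => /orP[|]; last exact: Hw.
  by move=> /(fsubsetP (msuppZ_le _ _)); apply: Hv.
rewrite -mcoeff_neq0 act_coefE => avj.
have /hasP[i vi aji] : has (fun i => coef a j i != 0) (msupp v).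
  apply: contraNT avj => /hasPn a0; rewrite big1_seq // => i /= /a0.
  by rewrite negbK => /eqP ->; rewrite mulr0.
exact: reachable_step Aa aji (Hv i vi).
Qed.

Lemma generated_module_invariant k :
  invariant (generated_module hbar theta delta A k).
Proof.
split=> [W [[]]//|c v w Mv Mw W WP|a v Aa Mv W WP]; have [[_ WZD Wact] _] := WP.
  by apply: WZD; [apply: Mv|apply: Mw].
by apply: Wact => //; apply: Mv.
Qed.

Lemma generated_module_reachable k v :
  generated_module hbar theta delta A k v ->
  {in msupp v, forall j, reachable k j}.
Proof.
move=> /(_ [set w | {in msupp w, forall j, reachable k j}]); apply.
split; first exact: reachable_invariant.
by move=> _ -> j /(fsubsetP msuppU_le); rewrite inE => /eqP; left.
Qed.

Lemma nonzero_invariant_ket (W : set (shift_module R D)) k v :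
  invariant W -> W `<=` generated_module hbar theta delta A k ->
  W v -> v != 0 -> W (ket R k).
Proof.
move=> Winv WM Wv v0; have [] := boolP (has (predC1 k) (msupp v)).
  move=> /hasP[j vj /= jk].
  have [/eqP|[a Aa ajk]] := generated_module_reachable (WM _ Wv) vj.
    by rewrite (negbTE jk).
  have [f Ff [f1 f0]] := indicator (msupp v) j.
  have [_ _ _ Fconj] := Falg; have [_ _ _ Astar AF] := Asub.
  (* The star of (conj f) a is (star a) f, and f keeps only the j-th coordinate
     of v; so it maps v to an element with k-th coordinate v_j conj(<j|a|k>). *)
  apply: (@invariant_ket _ _ _ _ Winv
    (Astar _ (AF _ _ (Fconj _ Ff) Aa)) Wv).
  rewrite act_coefE.
  pose h i := v@_i * (coef a i k)^*.
  suff -> : \sum_(i <- msupp v) v@_i * coef (shift_star hbar theta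
      (shift_mul hbar theta << conjf f *g 0 >> a)) k i = h j.
    by rewrite mulf_neq0 ?mcoeff_neq0 ?conjc_eq0.
  rewrite -(@sum_msupp_pick _ _ _ v j h) => [|vj0]; last by rewrite /h vj0 mul0r.
  rewrite big_seq [RHS]big_seq; apply: eq_bigr => i vi.
  rewrite act_coef_star act_coef_funM rmorphM /=.
  rewrite [(conjf _ _)^*]conjcK.
  have [->|ij] := eqVneq i j; first by rewrite f1 mul1r.
  by rewrite f0 ?mul0r ?mulr0.
(* Otherwise [v] is supported at [k] alone, and rescaling it gives the ket without acting by [A]. *)
move=> /hasPn vk.
have vE : v = v@_k *: ket R k.
  apply/malgP => i; rewrite mcoeffZ mcoeffU.
  have [<-|ki] := eqVneq k i; first by rewrite mulr1.
  rewrite mulr0; apply/eqP; rewrite mcoeff_eq0; apply/negP => /vk /=.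
  by rewrite negbK eq_sym (negbTE ki).
rewrite vE in Wv; apply: (invariant_scale_ket Winv _ Wv).
by apply: contraNneq v0 => vk0; rewrite vE vk0 scale0r.
Qed.

Lemma generated_module_simple k :
  simple_module hbar theta delta A (generated_module hbar theta delta A k).
Proof.
split; first exact: generated_module_invariant.
  move=> M0; have : generated_module hbar theta delta A k (ket R k).
    by move=> W [_]; apply.
  rewrite M0 => /eqP; apply/negP.
  by rewrite monalgU_eq0 oner_eq0.
move=> W Winv WM.
have [[v Wv v0]|W0] := pselect (exists2 v, W v & v != 0).
  (* Once [W] contains the generator, minimality of the generated module puts that module inside
     [W]. *)
  right; apply/seteqP; split=> // w; apply; split=> // _ ->.
  exact: nonzero_invariant_ket Winv WM Wv v0.
left; apply/seteqP; split=> [v Wv|_ ->]; last by case: Winv.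
by apply/eqP; apply: contra_notT W0 => v0; exists v.
Qed.

End SimpleModule.

Theorem proposition4p2 (R : realType) (D : nat) (hD : (1 <= D)%N)
  (hbar : R) (hhbar : 0 < hbar)
  (q : R[i]) (hq : `|q| = 1) (theta : R) (htheta : q = expi theta)
  (F : set (cfun R D))
  (hF : fun_star_subalgebra F) (hFinv : hbar_invariant hbar F)
  (hFsep : separates_points F)
  (A : set (formal_sum R D)) (hA : shift_subalgebra hbar theta F A)
  (delta : 'rV[R]_D) (k : 'rV[int]_D) :
  simple_module hbar theta delta A (generated_module hbar theta delta A k).
Proof. exact: generated_module_simple hFsep _ hA _ _. Qed.
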